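(* Let $d$ be a nonnegative integer and $\delta\in\{0,1\}$. Then $$C_d=(1-2\delta)\sum_{0\le k<d}C_k+(-1)^{\delta}\sum_{i=0}^d\left(\frac{i-\delta}3\right)C_{d,i+1}+1+\delta=\frac12\sum_{j=1}^{d+1}(1-3[3\mid j])C_{d,j}+\frac32.$$ Also, $$\sum_{k=0}^dkC_{d-k}=\sum_{j=1}^{d+1}\left(\frac{j-1}3\right)\left(2\binom{2d}{d-j}-(d+1)C_{d,j}\right)-d=\sum_{j=1}^{d+1}\left(\frac{j+1}3\right)\left(2\binom{2d}{d-j}-(d+1)C_{d,j}\right)+2d+1,$$ and $$\sum_{0<k\le d}\left(k-\frac23\right)C_{d-k}+\frac13\sum_{j=1}^{d+1}jC_{d,j}=\sum_{\substack{1\le j\le d+1\\ j\equiv1\ (\mathrm{mod}\ 3)}}jC_{d,j}-d+\frac23=\sum_{\substack{1\le j\le d+1\\ j\equiv2\ (\mathrm{mod}\ 3)}}jC_{d,j}+2d-\frac13.$$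
   Context: $C_n=\frac1{n+1}\binom{2n}n$ is the $n$-th Catalan number. For $n\in\{0,1,2,\ldots\}$ and $j\in\{0,\ldots,n+1\}$, $C_{n,j}=2\binom{2n}{n-j}-\binom{2n}{n-1-j}-\binom{2n}{n+1-j}$, where $\binom{N}{k}=0$ for $k<0$ or $k>N$. For an integer $a$ (possibly negative), $\left(\frac a3\right)$ is the unique integer in $\{0,\pm1\}$ congruent to $a$ mod $3$. $[A]=1$ if assertion $A$ holds and $0$ otherwise. *)

(* Defs.v *)
From mathcomp Require Export all_boot all_order all_algebra.

Set Implicit Arguments.
Unset Strict Implicit.
Unset Printing Implicit Defensive.

Import GRing.Theory Num.Theory.
Local Open Scope ring_scope.

Definition catalan (n : nat) : rat := ('C(n.*2, n))%:R / (n.+1)%:R.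

(* The lower index may be negative, hence in int; 'C(N, m) is already 0 for
   m > N. *)
Definition binz (N : nat) (k : int) : nat :=
  if k is Posz m then 'C(N, m) else 0%N.

Definition catalan2 (n j : nat) : int :=
  2 * (binz n.*2 (n%:Z - j%:Z))%:Z
  - (binz n.*2 (n%:Z - 1 - j%:Z))%:Z
  - (binz n.*2 (n%:Z + 1 - j%:Z))%:Z.

Definition leg3 (a : int) : int :=
  if (a %% 3)%Z == 0 then 0 else if (a %% 3)%Z == 1 then 1 else -1.

Lemma leg3P (a b : int) :
  b = leg3 a <-> (b \in [:: 0; 1; -1]) /\ (b = a %[mod 3])%Z.
Proof.
have lt3 : ((a %% 3)%Z < 3)%R by rewrite ltz_pmod.
have ge0 : (0 <= (a %% 3)%Z)%R by rewrite modz_ge0.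
rewrite /leg3; move: (a %% 3)%Z lt3 ge0 => [] // [|[|[|]]] // _ _ /=.
all: split=> [->|] //.
all: by case; rewrite !inE => /or3P[] /eqP-> //.
Qed.

(* Main.v *)
Require Import Defs.
From mathcomp Require Import all_boot all_order all_algebra.
From mathcomp Require Import ring lra zify.
Local Open Scope ring_scope.

Set Implicit Arguments.
Unset Strict Implicit.

Import GRing.Theory Num.Theory.

(** All sums reduce to the coefficients [cbin d j] of [x ^ j] in
    [(x + 2 + 1 / x) ^ d]: [catalan2 d] is minus their second difference.
    For a weight [w] of period 3 and mean 0, minus the second difference of
    [w] is [3 * w], so summation by parts turns the recurrence of [cbin] in [d]
    into [S (d + 1) = S d + w 1 * cbin d 0 - w 0 * cbin d 1] for
    [S d = \sum_(j >= 1) w j * cbin d j], which is solved in terms of the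
    Catalan numbers and their partial sums.  The sums with an extra factor [j]
    reduce to these through
    [j * cbin d.+1 j = d.+1 * (cbin d (j - 1) - cbin d (j + 1))]. *)

(** * Binomial coefficients centred at [d] and their recurrences *)

Definition cbin (d j : nat) : rat := 'C(d.*2, d + j)%:R.

Lemma cbin_small d j : (d < j)%N -> cbin d j = 0.
Proof. by move=> dj; rewrite /cbin bin_small //; lia. Qed.

Lemma binz_cbin d j : (binz d.*2 (d%:Z - j%:Z))%:R = cbin d j.
Proof.
have [jd|dj] := leqP j d.
  rewrite /cbin (_ : d%:Z - j%:Z = (d - j)%N%:Z); last by lia.
  rewrite /binz -bin_sub; last by lia.
  by congr ('C(_, _)%:R); lia.
by rewrite cbin_small // (_ : d%:Z - j%:Z = Negz (j - d).-1) //; lia.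
Qed.

Lemma catalan2S d j :
  (catalan2 d j.+1)%:~R = 2 * cbin d j.+1 - cbin d j.+2 - cbin d j.
Proof.
rewrite -!binz_cbin /catalan2.
rewrite (_ : d%:Z - 1 - j.+1%:Z = d%:Z - j.+2%:Z); last by lia.
rewrite (_ : d%:Z + 1 - j.+1%:Z = d%:Z - j%:Z); last by lia.
by rewrite !rmorphB rmorphM /= -!pmulrn.
Qed.

Lemma cbinSS d j :
  cbin d.+1 j.+1 = cbin d j + 2 * cbin d j.+1 + cbin d j.+2.
Proof.
rewrite /cbin doubleS addSn !addnS !binS !natrD.
by generalize 'C(d.*2, (d + j).+2) 'C(d.*2, (d + j).+1) 'C(d.*2, d + j)
  => x y z; ring.
Qed.

(** This is the pattern of [cbinSS] at index 0, with the coefficient at -1 replaced by the one at 1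
    through the symmetry of the binomials. *)
Lemma cbinS d : cbin d.+1 0 = 2 * cbin d 0 + 2 * cbin d 1.
Proof.
rewrite /cbin !addn0 addn1.
case: d => [|d]; first by rewrite !bin0.
have sym : 'C(d.+1.*2, d) = 'C(d.+1.*2, d.+2).
  by rewrite -bin_sub; [congr 'C(_, _); lia | lia].
rewrite (doubleS d.+1); move: (d.+1.*2) sym => n sym.
rewrite !binS sym !natrD.
by generalize 'C(n, d.+2) 'C(n, d.+1) => x y; ring.
Qed.

Lemma cbin_ratio d j :
  (d%:R + j%:R + 1) * cbin d j.+1 = (d%:R - j%:R) * cbin d j.
Proof.
have [jd|dj] := leqP j d; last by rewrite !cbin_small ?mulr0 //; lia.
rewrite /cbin addnS -natrD natr1 -natrB // -!natrM mul_bin_left.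
by congr ((_ * _)%:R); lia.
Qed.

(** Applying [x d/dx] to [(x + 2 + 1/x) ^ d.+1] gives [d.+1 * (x - 1/x) * (x + 2 + 1/x) ^ d]; the
    identity compares coefficients. After [cbinSS] it is a combination of two instances of
    [cbin_ratio]. *)
Lemma cbin_derive d j :
  j.+1%:R * cbin d.+1 j.+1 = d.+1%:R * (cbin d j - cbin d j.+2).
Proof.
have := cbin_ratio d j; have := cbin_ratio d j.+1.
rewrite cbinSS -!natr1; nra.
Qed.

Lemma cbin0 d : cbin d 0 = (d%:R + 1) * catalan d.
Proof.
by rewrite /cbin /catalan addn0 natr1 mulrCA mulfV ?mulr1 // pnatr_eq0.
Qed.

Lemma cbin1 d : cbin d 1 = d%:R * catalan d.
Proof.
have n1 : d%:R + 1 != 0 :> rat by rewrite natr1 pnatr_eq0.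
apply: (mulfI n1); have := cbin_ratio d 0.
by rewrite cbin0 addr0 => ->; ring.
Qed.

Lemma catalanS d :
  catalan d.+1 = (4 * d%:R + 2) / (d%:R + 2) * catalan d.
Proof.
have n2 : d%:R + 2 != 0 :> rat by rewrite -natrD pnatr_eq0 addn2.
apply: (mulfI n2); have := cbinS d.
rewrite !cbin0 cbin1 -natr1 => E.
by transitivity ((d%:R + 1 + 1) * catalan d.+1); [ring | rewrite E; field].
Qed.

(** * Summation by parts *)

Lemma sum_second_diff (w f : nat -> rat) N :
  \sum_(0 <= j < N) w j.+1 * (2 * f j.+1 - f j.+2 - f j)
  = \sum_(0 <= j < N) (2 * w j.+1 - w j - w j.+2) * f j.+1
    - w 1%N * f 0%N + w 0%N * f 1%N + w N.+1 * f N - w N * f N.+1.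
Proof.
elim: N => [|N IH]; first by rewrite !big_geq //; ring.
by rewrite !big_nat_recr //= IH; ring.
Qed.

Lemma sum_central_diff (w f : nat -> rat) N :
  \sum_(0 <= j < N) w j.+1 * (f j - f j.+2)
  = \sum_(0 <= j < N) (w j.+2 - w j) * f j.+1
    + w 1%N * f 0%N + w 0%N * f 1%N - w N.+1 * f N - w N * f N.+1.
Proof.
elim: N => [|N IH]; first by rewrite !big_geq //; ring.
by rewrite !big_nat_recr //= IH; ring.
Qed.

(** Subtracting consecutive instances gives [w j.+3 = w j], so this one condition encodes both
    period 3 and mean 0. *)
Definition balanced3 (w : nat -> rat) := forall j, w j + w j.+1 + w j.+2 = 0.

(** The bound [N] is free above [d], so that sums for different [d] share one range; there the
    boundary terms at [N] vanish. *)
Lemma sum_catalan2 (w : nat -> rat) d N : balanced3 w -> (d < N)%N ->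
  \sum_(0 <= j < N) w j.+1 * (catalan2 d j.+1)%:~R
  = 3 * (\sum_(0 <= j < N) w j.+1 * cbin d j.+1)
    - w 1%N * cbin d 0 + w 0%N * cbin d 1.
Proof.
move=> w3 dN; under eq_bigr do rewrite catalan2S.
rewrite sum_second_diff (cbin_small dN) (cbin_small (leqW dN)).
rewrite !mulr0 addr0 subr0 mulr_sumr; congr (_ - _ + _).
by apply: eq_bigr => j _; have := w3 j; nra.
Qed.

Lemma sum_cbinS (w : nat -> rat) d N : balanced3 w -> (d < N)%N ->
  \sum_(0 <= j < N) w j.+1 * cbin d.+1 j.+1
  = \sum_(0 <= j < N) w j.+1 * cbin d j.+1
    + w 1%N * cbin d 0 - w 0%N * cbin d 1.
Proof.
move=> w3 dN.
(* From [x + 2 + 1/x = 4 - (2 - x - 1/x)]: the next row is [4 * cbin d] minus [catalan2 d]. *)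
transitivity (4 * (\sum_(0 <= j < N) w j.+1 * cbin d j.+1)
  - \sum_(0 <= j < N) w j.+1 * (catalan2 d j.+1)%:~R).
  rewrite mulr_sumr -sumrB; apply: eq_bigr => j _.
  by rewrite catalan2S cbinSS; ring.
by rewrite (sum_catalan2 w3 dN); ring.
Qed.

Lemma sum_cbin_derive (w : nat -> rat) d N : (d < N)%N ->
  \sum_(0 <= j < N) w j.+1 * (j.+1%:R * cbin d.+1 j.+1)
  = d.+1%:R * (\sum_(0 <= j < N) (w j.+2 - w j) * cbin d j.+1
               + w 1%N * cbin d 0 + w 0%N * cbin d 1).
Proof.
move=> dN; under eq_bigr do rewrite cbin_derive mulrCA.
rewrite -mulr_sumr sum_central_diff (cbin_small dN) (cbin_small (leqW dN)).
by rewrite !mulr0 !subr0.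
Qed.

Lemma sum_mul_catalan2 (w : nat -> rat) d N :
  \sum_(0 <= j < N) w j.+1 * (j.+1%:R * (catalan2 d j.+1)%:~R)
  = 4 * (\sum_(0 <= j < N) w j.+1 * (j.+1%:R * cbin d j.+1))
    - \sum_(0 <= j < N) w j.+1 * (j.+1%:R * cbin d.+1 j.+1).
Proof.
rewrite mulr_sumr -sumrB; apply: eq_bigr => j _.
by rewrite catalan2S cbinSS; ring.
Qed.

(** * Weights of period 3 *)

Definition leg3m1 (j : nat) : rat := (leg3 (j%:Z - 1))%:~R.

(** This is minus the trace [z ^ j + z ^ (-j)] of a primitive cube root of unity [z]. Together with
    [leg3m1] it spans all balanced weights. *)
Definition nmult3 (j : nat) : rat := 1 - 3 * (3 %| j)%N%:R.

Lemma leg3_add3 (a : int) : leg3 (a + 3) = leg3 a.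
Proof. by rewrite /leg3 modzDr. Qed.

(** Reduces identities between functions of period 3 to a computation at 0, 1 and 2. *)
Lemma ind3 (P : nat -> Prop) :
  P 0%N -> P 1%N -> P 2%N -> (forall j, P j -> P j.+3) -> forall j, P j.
Proof.
move=> P0 P1 P2 PS j.
suff [] : [/\ P j, P j.+1 & P j.+2] by [].
by elim: j => // j [? ? ?]; split=> //; apply: PS.
Qed.

Lemma leg3_period (a : int) (j : nat) : leg3 (j.+3%:Z + a) = leg3 (j%:Z + a).
Proof. by rewrite -[RHS]leg3_add3; congr leg3; lia. Qed.

Lemma leg3m1_period j : leg3m1 j.+3 = leg3m1 j.
Proof. by rewrite /leg3m1 leg3_period. Qed.

Lemma nmult3_period j : nmult3 j.+3 = nmult3 j.
Proof. by rewrite /nmult3 -(addn3 j) dvdn_addl. Qed.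

Lemma leg3m1_balanced : balanced3 leg3m1.
Proof. by elim/ind3 => // j IH; rewrite !leg3m1_period. Qed.

Lemma nmult3_balanced : balanced3 nmult3.
Proof. by elim/ind3 => // j IH; rewrite !nmult3_period. Qed.

Lemma leg3p1E j : (leg3 (j%:Z + 1))%:~R = leg3m1 j - nmult3 j.
Proof.
by elim/ind3: j => // j IH; rewrite leg3m1_period nmult3_period leg3_period.
Qed.

Lemma leg3m0E (j : nat) : (leg3 (j%:Z - 0%N%:Z))%:~R = leg3m1 j.+1.
Proof. by rewrite /leg3m1; congr (_%:~R); congr leg3; lia. Qed.

(** Modulo 3, [j - 1] is [j.+1 + 1], so [leg3p1E] applies; this is the weight of the case
    [delta = 1]. *)
Lemma leg3m2E j : (leg3 (j%:Z - 1))%:~R = leg3m1 j.+1 - nmult3 j.+1.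
Proof. by rewrite -leg3p1E -leg3_add3; congr (_%:~R); congr leg3; lia. Qed.

(** * Closed forms for the sums against the two weights *)

Definition catsum (d : nat) : rat := \sum_(0 <= k < d) catalan k.

Lemma catsumS d : catsum d.+1 = catsum d + catalan d.
Proof. by rewrite /catsum big_nat_recr. Qed.

Lemma sum_leg3m1_cbin d N : (d <= N)%N ->
  \sum_(0 <= j < N) leg3m1 j.+1 * cbin d j.+1
  = ((d%:R + 1) * catalan d - catsum d - 1) / 3.
Proof.
elim: d => [|d IH] dN.
  rewrite big1 => [|j _]; last by rewrite cbin_small ?mulr0.
  by rewrite /catsum big_geq.
rewrite (sum_cbinS leg3m1_balanced dN) IH; last exact: ltnW.
(* With these two values the increment is [cbin d 1 = d * catalan d]. *)
rewrite cbin0 cbin1 (_ : leg3m1 1 = 0) // (_ : leg3m1 0 = -1) //.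
have n2 : d%:R + 2 != 0 :> rat by rewrite -natrD pnatr_eq0 addn2.
by rewrite catsumS -natr1 catalanS; field.
Qed.

(** The increment [cbin d 0 + 2 * cbin d 1] equals [cbin d.+1 0 - cbin d 0], so the sum
    telescopes. *)
Lemma sum_nmult3_cbin d N : (d <= N)%N ->
  \sum_(0 <= j < N) nmult3 j.+1 * cbin d j.+1 = cbin d 0 - 1.
Proof.
elim: d => [|d IH] dN.
  rewrite big1 => [|j _]; last by rewrite cbin_small ?mulr0.
  by rewrite /cbin bin0 subrr.
rewrite (sum_cbinS nmult3_balanced dN) IH; last exact: ltnW.
by rewrite (_ : nmult3 1 = 1) // (_ : nmult3 0 = -2) // cbinS; ring.
Qed.

Lemma sum_leg3m1_catalan2 d :
  \sum_(0 <= j < d.+1) leg3m1 j.+1 * (catalan2 d j.+1)%:~R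
  = catalan d - catsum d - 1.
Proof.
rewrite (sum_catalan2 leg3m1_balanced) // sum_leg3m1_cbin //.
by rewrite (_ : leg3m1 1 = 0) // (_ : leg3m1 0 = -1) // cbin1; field.
Qed.

Lemma sum_nmult3_catalan2 d :
  \sum_(0 <= j < d.+1) nmult3 j.+1 * (catalan2 d j.+1)%:~R
  = 2 * catalan d - 3.
Proof.
rewrite (sum_catalan2 nmult3_balanced) // sum_nmult3_cbin //.
by rewrite (_ : nmult3 1 = 1) // (_ : nmult3 0 = -2) // cbin0 cbin1; ring.
Qed.

(** * Linearly weighted sums of Catalan numbers *)

Lemma catsum_rev d : \sum_(0 <= k < d.+1) catalan (d - k) = catsum d.+1.
Proof. by rewrite /catsum [RHS]big_nat_rev. Qed.

Lemma sum_mul_catalan d :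
  \sum_(0 <= k < d.+1) k%:R * catalan (d - k)
  = ((3 * d%:R + 1) * catsum d - (d%:R + 1) * catalan d + 1) / 3.
Proof.
elim: d => [|d IH].
  by rewrite /catsum big_nat1 big_geq.
rewrite big_nat_recl // mul0r add0r.
(* Shifting [k] by one adds each Catalan number once, hence the increment [catsum d.+1]. *)
transitivity (\sum_(0 <= k < d.+1) k%:R * catalan (d - k)
              + \sum_(0 <= k < d.+1) catalan (d - k)).
  by rewrite -big_split /=; apply: eq_bigr => k _; rewrite -natr1 subSS; ring.
have n2 : d%:R + 2 != 0 :> rat by rewrite -natrD pnatr_eq0 addn2.
by rewrite IH catsum_rev catsumS -natr1 catalanS; field.
Qed.

Lemma sum_shift_mul_catalan d :
  \sum_(1 <= k < d.+1) (k%:R - 2 / 3) * catalan (d - k)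
  = \sum_(0 <= k < d.+1) k%:R * catalan (d - k) - 2 / 3 * catsum d.
Proof.
rewrite [in RHS]big_ltn // mul0r add0r.
under [LHS]eq_bigr do rewrite mulrBl.
rewrite sumrB -mulr_sumr; congr (_ - _ * _); rewrite big_add1 /=.
case: d => [|d]; first by rewrite /catsum !big_geq.
by rewrite -catsum_rev; apply: eq_bigr => k _; rewrite subSS.
Qed.

(** * Sums over residue classes modulo 3 *)

Definition third_dev (r j : nat) : rat := (j %% 3 == r)%N%:R - 1 / 3.

(** The indicator of a residue class is split into its mean 1/3 and its deviation; the mean produces
    the term [1 / 3 * \sum j * catalan2 d j] of the third chain. *)
Lemma sum_nat_mod3 r (F : nat -> rat) m n :
  \sum_(m <= j < n | (j %% 3 == r)%N) F j
  = \sum_(m <= j < n) third_dev r j * F j + 1 / 3 * \sum_(m <= j < n) F j.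
Proof.
rewrite big_mkcond mulr_sumr -big_split /=; apply: eq_bigr => j _.
by rewrite /third_dev; case: eqP => _ /=; ring.
Qed.

Lemma third_dev_period r j : third_dev r j.+3 = third_dev r j.
Proof. by rewrite /third_dev -(addn3 j) modnDr. Qed.

(** The factor [j] turns weights into their central differences, which are balanced and so reduce to
    the two basic weights. *)
Lemma third_dev1_central j : third_dev 1 j.+2 - third_dev 1 j = - leg3m1 j.+1.
Proof.
by elim/ind3: j => // j IH; rewrite !third_dev_period leg3m1_period.
Qed.

Lemma third_dev2_central j :
  third_dev 2 j.+2 - third_dev 2 j = nmult3 j.+1 - leg3m1 j.+1.
Proof.
by elim/ind3: j => // j IH;
  rewrite !third_dev_period leg3m1_period nmult3_period.
Qed.

Lemma sum_third_dev1_cbin d N : (d <= N)%N ->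
  \sum_(0 <= j < N) third_dev 1 j.+1 * (j.+1%:R * cbin d j.+1)
  = d%:R * (catsum d + 1) / 3.
Proof.
case: d => [|d] dN.
  by rewrite big1 ?mul0r // => j _; rewrite cbin_small ?mulr0.
rewrite sum_cbin_derive //.
under eq_bigr do rewrite third_dev1_central mulNr.
rewrite sumrN sum_leg3m1_cbin; last exact: ltnW.
rewrite (_ : third_dev 1 1 = 2 / 3) // (_ : third_dev 1 0 = - (1 / 3)) //.
by rewrite cbin0 cbin1 catsumS; field.
Qed.

Lemma sum_third_dev2_cbin d N : (d <= N)%N ->
  \sum_(0 <= j < N) third_dev 2 j.+1 * (j.+1%:R * cbin d j.+1)
  = d%:R * (catsum d - 2) / 3.
Proof.
case: d => [|d] dN.
  by rewrite big1 ?mul0r // => j _; rewrite cbin_small ?mulr0.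
rewrite sum_cbin_derive //.
under eq_bigr do rewrite third_dev2_central mulrBl.
rewrite sumrB sum_leg3m1_cbin; last exact: ltnW.
rewrite sum_nmult3_cbin; last exact: ltnW.
rewrite (_ : third_dev 2 1 = - (1 / 3)) // (_ : third_dev 2 0 = - (1 / 3)) //.
by rewrite cbin0 cbin1 catsumS; field.
Qed.

(** * Assembly of the three chains *)

Lemma sum_binz_catalan2 (w : nat -> rat) d :
  \sum_(1 <= j < d.+2)
    w j * (2 * (binz d.*2 (d%:Z - j%:Z))%:R - (d%:R + 1) * (catalan2 d j)%:~R)
  = 2 * (\sum_(0 <= j < d.+1) w j.+1 * cbin d j.+1)
    - (d%:R + 1) * (\sum_(0 <= j < d.+1) w j.+1 * (catalan2 d j.+1)%:~R).
Proof.
rewrite big_add1 /= !mulr_sumr -sumrB; apply: eq_bigr => j _.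
by rewrite binz_cbin; ring.
Qed.

Theorem theorem1p4 (d delta : nat) (hdelta : delta = 0%N \/ delta = 1%N) :
  [/\ catalan d
      = (1 - 2 * delta%:R) * (\sum_(0 <= k < d) catalan k)
        + (-1) ^+ delta
          * (\sum_(0 <= i < d.+1)
               (leg3 (i%:Z - delta%:Z))%:~R * (catalan2 d i.+1)%:~R)
        + 1 + delta%:R
    /\ (1 - 2 * delta%:R) * (\sum_(0 <= k < d) catalan k)
        + (-1) ^+ delta
          * (\sum_(0 <= i < d.+1)
               (leg3 (i%:Z - delta%:Z))%:~R * (catalan2 d i.+1)%:~R)
        + 1 + delta%:R
      = 1 / 2 * (\sum_(1 <= j < d.+2)
                   (1 - 3 * (3 %| j)%N%:R) * (catalan2 d j)%:~R)
        + 3 / 2 :> rat,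
      \sum_(0 <= k < d.+1) k%:R * catalan (d - k)
      = (\sum_(1 <= j < d.+2)
           (leg3 (j%:Z - 1))%:~R
           * (2 * (binz d.*2 (d%:Z - j%:Z))%:R - (d%:R + 1) * (catalan2 d j)%:~R))
        - d%:R
    /\ (\sum_(1 <= j < d.+2)
           (leg3 (j%:Z - 1))%:~R
           * (2 * (binz d.*2 (d%:Z - j%:Z))%:R - (d%:R + 1) * (catalan2 d j)%:~R))
        - d%:R
      = (\sum_(1 <= j < d.+2)
           (leg3 (j%:Z + 1))%:~R
           * (2 * (binz d.*2 (d%:Z - j%:Z))%:R - (d%:R + 1) * (catalan2 d j)%:~R))
        + 2 * d%:R + 1 :> rat
    & (\sum_(1 <= k < d.+1) (k%:R - 2 / 3) * catalan (d - k))
        + 1 / 3 * (\sum_(1 <= j < d.+2) j%:R * (catalan2 d j)%:~R)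
      = (\sum_(1 <= j < d.+2 | (j == 1 %[mod 3])%N) j%:R * (catalan2 d j)%:~R)
        - d%:R + 2 / 3
    /\ (\sum_(1 <= j < d.+2 | (j == 1 %[mod 3])%N) j%:R * (catalan2 d j)%:~R)
        - d%:R + 2 / 3
      = (\sum_(1 <= j < d.+2 | (j == 2 %[mod 3])%N) j%:R * (catalan2 d j)%:~R)
        + 2 * d%:R - 1 / 3 :> rat].
Proof.
have E1 : \sum_(1 <= j < d.+2)
    leg3m1 j * (2 * (binz d.*2 (d%:Z - j%:Z))%:R
                - (d%:R + 1) * (catalan2 d j)%:~R)
  = 2 / 3 * ((d%:R + 1) * catalan d - catsum d - 1)
    - (d%:R + 1) * (catalan d - catsum d - 1).
  by rewrite sum_binz_catalan2 sum_leg3m1_catalan2 sum_leg3m1_cbin //; field.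
have E2 : \sum_(1 <= j < d.+2)
    nmult3 j * (2 * (binz d.*2 (d%:Z - j%:Z))%:R
                - (d%:R + 1) * (catalan2 d j)%:~R)
  = 3 * d%:R + 1.
  rewrite sum_binz_catalan2 sum_nmult3_catalan2 sum_nmult3_cbin //.
  by rewrite cbin0; ring.
have E3 : \sum_(1 <= j < d.+2) (leg3 (j%:Z + 1))%:~R
     * (2 * (binz d.*2 (d%:Z - j%:Z))%:R - (d%:R + 1) * (catalan2 d j)%:~R)
  = 2 / 3 * ((d%:R + 1) * catalan d - catsum d - 1)
    - (d%:R + 1) * (catalan d - catsum d - 1) - (3 * d%:R + 1).
  rewrite -E1 -E2 -sumrB; apply: eq_bigr => j _.
  by rewrite leg3p1E mulrBl.
split.
- have nm : \sum_(1 <= j < d.+2)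
      (1 - 3 * (3 %| j)%N%:R) * (catalan2 d j)%:~R = 2 * catalan d - 3.
    by rewrite big_add1 /= -sum_nmult3_catalan2.
  (* By [nm] the last member of the chain is already [catalan d], so only the first equality
     remains. *)
  suff E : catalan d = (1 - 2 * delta%:R) * catsum d
        + (-1) ^+ delta
          * (\sum_(0 <= i < d.+1)
               (leg3 (i%:Z - delta%:Z))%:~R * (catalan2 d i.+1)%:~R)
        + 1 + delta%:R.
    by split=> //; rewrite -[LHS]E nm; field.
  case: hdelta => ->.
    under eq_bigr do rewrite leg3m0E.
    by rewrite sum_leg3m1_catalan2 expr0; ring.
  under eq_bigr do rewrite leg3m2E mulrBl.
  by rewrite sumrB sum_leg3m1_catalan2 sum_nmult3_catalan2 expr1; ring.
- by split; rewrite -/leg3m1 ?sum_mul_catalan E1 ?E3; field.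
- have E4 r : \sum_(1 <= j < d.+2 | (j == r %[mod 3])%N)
      j%:R * (catalan2 d j)%:~R
    = \sum_(0 <= j < d.+1) third_dev (r %% 3) j.+1
        * (j.+1%:R * (catalan2 d j.+1)%:~R)
      + 1 / 3 * \sum_(1 <= j < d.+2) j%:R * (catalan2 d j)%:~R.
    by rewrite sum_nat_mod3 big_add1.
  (* The sum over all [j] now has coefficient 1/3 in every member and cancels. *)
  rewrite sum_shift_mul_catalan sum_mul_catalan !E4 !sum_mul_catalan2.
  rewrite !sum_third_dev1_cbin // !sum_third_dev2_cbin //.
  rewrite catsumS.
  by split; field.
Qed.
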